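(* Let $n\ge 2$. There is no constant $c>0$ such that for every $X\in\mathbb{M}_n$ there exists a unitary $U\in\mathbb{M}_n$ satisfying $$|X|_{\mathrm{qsym}}\le c\,U\,|X|_{\mathrm{sym}}\,U^*.$$
   Context: $\mathbb{M}_n$ is the set of $n\times n$ complex matrices, $X^*$ is the conjugate transpose of $X$, and $|X|:=(X^*X)^{1/2}$. The arithmetic symmetric modulus is $|X|_{\mathrm{sym}}:=\frac{|X|+|X^*|}{2}$ and the quadratic symmetric modulus is $|X|_{\mathrm{qsym}}:=\left(\frac{|X|^2+|X^*|^2}{2}\right)^{1/2}$. The inequality $\le$ between Hermitian matrices is the Loewner (positive semidefinite) order. *)

(* Defs.v *)
From mathcomp Require Import all_boot all_order all_algebra.
From mathcomp Require Import sesquilinear spectral.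
From mathcomp Require Import complex.
From mathcomp Require Import reals.

Set Implicit Arguments.
Unset Strict Implicit.
Unset Printing Implicit Defensive.

Import Order.TTheory GRing.Theory Num.Theory.
Local Open Scope ring_scope.
Local Open Scope sesquilinear_scope.

Section SymmetricModulus.
Variables (C : numClosedFieldType) (n : nat).
Implicit Types A B X : 'M[C]_n.

(* In C, 0 <= z says that z is real and nonnegative. *)
Definition psdmx A : Prop :=
  A \is hermsymmx /\ forall x : 'cV[C]_n, 0 <= (x ^t* *m A *m x) 0 0.

Definition loewner_le A B : Prop := psdmx (B - A).

(* The square root by functional calculus on the spectral decomposition
   A = P^-1 diag(d) P with P unitary.  It is meaningful for psd A only, where
   sqrtmx_psd, sqrtmx_sqr and sqrtmx_unique below say that it is the unique psd
   matrix with square A. *)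
Definition sqrtmx A : 'M[C]_n :=
  invmx (spectralmx A) *m diag_mx (map_mx sqrtC (spectral_diag A))
    *m spectralmx A.

Definition absmx X : 'M[C]_n := sqrtmx (X ^t* *m X).

Definition symabsmx X : 'M[C]_n := 2^-1 *: (absmx X + absmx (X ^t*)).

Definition qsymabsmx X : 'M[C]_n :=
  sqrtmx (2^-1 *: (absmx X *m absmx X + absmx (X ^t*) *m absmx (X ^t*))).

Lemma hermsymmx_trC A : A \is hermsymmx -> A ^t* = A.
Proof. by move=> /is_hermitianmxP; rewrite expr0 scale1r => {2}->. Qed.

Lemma trC_hermsymmx A : A ^t* = A -> A \is hermsymmx.
Proof. by move=> AE; apply/is_hermitianmxP; rewrite expr0 scale1r AE. Qed.

Lemma trC_mul m p q (A : 'M[C]_(m, p)) (B : 'M_(p, q)) :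
  (A *m B) ^t* = B ^t* *m A ^t*.
Proof. by rewrite trmx_mul map_mxM. Qed.

Lemma psdmx_conj m (P : 'M[C]_(m, n)) (A : 'M[C]_m) :
  A \is hermsymmx -> (forall x : 'cV[C]_m, 0 <= (x ^t* *m A *m x) 0 0) ->
  psdmx (P ^t* *m A *m P).
Proof.
move=> hA pA; split=> [|x].
  apply: trC_hermsymmx; rewrite !trC_mul trmxCK mulmxA; congr (_ *m _ *m _).
  by move/is_hermitianmxP: hA; rewrite expr0 scale1r => {2}->.
by have := pA (P *m x); rewrite trC_mul !mulmxA.
Qed.

Lemma psdmx_gram X : psdmx (X ^t* *m X).
Proof.
split=> [|x]; first by apply: trC_hermsymmx; rewrite trC_mul trmxCK.
rewrite mulmxA -mulmxA -trC_mul !mxE; apply: sumr_ge0 => i _.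
by rewrite !mxE mulrC mul_conjC_ge0.
Qed.

Lemma psdmx_spectral_diag A : psdmx A ->
  A = (spectralmx A) ^t* *m diag_mx (spectral_diag A) *m spectralmx A /\
  forall i, 0 <= spectral_diag A 0 i.
Proof.
case=> hA pA; have uP := spectral_unitarymx A.
have /orthomx_spectralP := hermitian_normalmx hA.
rewrite invmx_unitary // => AE; split=> // i.
have := pA ((spectralmx A) ^t* *m delta_mx i 0).
rewrite [X in _ *m X *m _]AE trC_mul trmxCK !mulmxA.
rewrite -!mulmxA (mulmxA (spectralmx A)) (unitarymxP uP) mul1mx.
rewrite !(mulmxA (spectralmx A)) (unitarymxP uP) mul1mx.
rewrite (_ : (delta_mx i 0) ^t* = delta_mx 0 i); last first.
  by apply/matrixP=> j k; rewrite !mxE conjC_nat andbC.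
by rewrite mulmxA -rowE -colE !mxE eqxx mulr1n.
Qed.

Lemma diag_psd (d : 'rV[C]_n) : (forall i, 0 <= d 0 i) ->
  diag_mx d \is hermsymmx /\
  forall x : 'cV[C]_n, 0 <= (x ^t* *m diag_mx d *m x) 0 0.
Proof.
move=> d0; split=> [|x].
  apply: trC_hermsymmx; apply/matrixP=> i j; rewrite !mxE.
  have [->|_] := eqVneq j i; first by rewrite !mulr1n conj_Creal ?ger0_real.
  by rewrite !mulr0n conjC0.
rewrite -mulmxA mul_diag_mx !mxE; apply: sumr_ge0 => i _; rewrite !mxE.
by rewrite mulrCA mulr_ge0 // mulrC mul_conjC_ge0.
Qed.

Lemma sqrtmx_psd A : psdmx A -> psdmx (sqrtmx A).
Proof.
move=> /psdmx_spectral_diag[_ d0].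
rewrite /sqrtmx invmx_unitary ?spectral_unitarymx //.
have [|? ?] := @diag_psd (map_mx sqrtC (spectral_diag A)).
  by move=> i; rewrite mxE sqrtC_ge0.
exact: psdmx_conj.
Qed.

Lemma sqrtmx_sqr A : psdmx A -> sqrtmx A *m sqrtmx A = A.
Proof.
move=> /psdmx_spectral_diag[AE _].
rewrite /sqrtmx !mulmxA mulmxK ?spectral_unit //.
rewrite -(mulmxA (invmx _)) mulmx_diag [RHS]AE invmx_unitary ?spectral_unitarymx //.
congr (_ *m diag_mx _ *m _).
by apply/rowP=> i; rewrite !mxE -expr2 sqrtCK.
Qed.

Lemma psdmx_sqr_inj A B : psdmx A -> psdmx B -> A *m A = B *m B -> A = B.
Proof.
move=> /psdmx_spectral_diag[AE a0] /psdmx_spectral_diag[BE b0].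
have uP := spectral_unitarymx A; have uQ := spectral_unitarymx B.
move: AE BE a0 b0 uP uQ.
move: (spectralmx A) (spectral_diag A) (spectralmx B) (spectral_diag B).
move=> P a Q b -> -> a0 b0 uP uQ sqE.
have PP : P *m P ^t* = 1%:M by apply/unitarymxP.
have QQ : Q *m Q ^t* = 1%:M by apply/unitarymxP.
have PP' : P ^t* *m P = 1%:M by apply: mulmx1C.
have QQ' : Q ^t* *m Q = 1%:M by apply: mulmx1C.
pose W := P *m Q ^t*.
have sqW : diag_mx a *m diag_mx a *m W = W *m (diag_mx b *m diag_mx b).
  have := congr1 (fun M => P *m M *m Q ^t*) sqE.
  rewrite /W -!mulmxA (mulmxA P (P ^t*)) PP mul1mx QQ mulmx1.
  rewrite (mulmxA P (P ^t*)) PP mul1mx (mulmxA Q (Q ^t*)) QQ mul1mx.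
  exact.
have aW : diag_mx a *m W = W *m diag_mx b.
  apply/matrixP=> i j; rewrite mul_diag_mx mul_mx_diag !mxE -/W.
  move/matrixP/(_ i j): sqW.
  rewrite !mulmx_diag mul_diag_mx mul_mx_diag !mxE.
  set w := \sum_k _ => e.
  have [->|w0] := eqVneq w 0; first by rewrite mulr0 mul0r.
  rewrite mulrC; congr (_ * _); apply/eqP; rewrite -(@eqrXn2 _ 2) //.
  by rewrite !expr2; apply/eqP/(mulIf w0); rewrite e mulrC.
have := congr1 (fun M => P ^t* *m M *m Q) aW.
by rewrite /W !mulmxA PP' mul1mx -!mulmxA QQ' mulmx1.
Qed.

Lemma sqrtmx_unique A B : psdmx A -> psdmx B -> B *m B = A -> B = sqrtmx A.
Proof.
by move=> pA pB BA; apply: psdmx_sqr_inj; rewrite ?sqrtmx_sqr //; apply: sqrtmx_psd.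
Qed.

Lemma psdmxD A B : psdmx A -> psdmx B -> psdmx (A + B).
Proof.
move=> [hA pA] [hB pB]; split=> [|x].
  apply: trC_hermsymmx; rewrite linearD map_mxD.
  by congr (_ + _); apply: hermsymmx_trC.
by rewrite mulmxDr mulmxDl mxE addr_ge0.
Qed.

Lemma psdmxZ a A : 0 <= a -> psdmx A -> psdmx (a *: A).
Proof.
move=> a0 [hA pA]; split=> [|x].
  apply: trC_hermsymmx; rewrite linearZ map_mxZ /=.
  by congr (_ *: _); [apply/conj_Creal/ger0_real|apply: hermsymmx_trC].
by rewrite -scalemxAr -scalemxAl mxE mulr_ge0.
Qed.

Lemma absmx_psd X : psdmx (absmx X).
Proof. exact/sqrtmx_psd/psdmx_gram. Qed.

Lemma absmx_sqr X : absmx X *m absmx X = X ^t* *m X.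
Proof. exact/sqrtmx_sqr/psdmx_gram. Qed.

Lemma qsymabsmx_arg_psd X :
  psdmx (2^-1 *: (absmx X *m absmx X + absmx (X ^t*) *m absmx (X ^t*))).
Proof.
apply: psdmxZ; first by rewrite invr_ge0 ler0n.
by rewrite !absmx_sqr; apply: psdmxD; apply: psdmx_gram.
Qed.

Lemma symabsmx_psd X : psdmx (symabsmx X).
Proof.
apply: psdmxZ; first by rewrite invr_ge0 ler0n.
by apply: psdmxD; apply: absmx_psd.
Qed.

Lemma qsymabsmx_psd X : psdmx (qsymabsmx X).
Proof. exact/sqrtmx_psd/qsymabsmx_arg_psd. Qed.

End SymmetricModulus.

(* Main.v *)
Require Import Defs.
From mathcomp Require Import all_boot all_order all_algebra.
From mathcomp Require Import sesquilinear spectral.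
From mathcomp Require Import complex.
From mathcomp Require Import reals.
From mathcomp Require Import ring.

(** The two moduli scale differently on a nearly normal matrix of rank one.
    For vectors [x] and [y] of equal norm [r], the matrix [X = x y^*] has
    [|X| = y y^*] and [|X^*| = x x^*] ([absmx_outer]).  Take [x = e0 + t e1] and
    [y = e0 - t e1] with [t] small.  The cross terms cancel, so that
    [|X|_sym = diag(1, t^2, 0, ...)], while the quadratic modulus, a square root
    of [r^2 |X|_sym], is [r diag(1, t, 0, ...)] with [r^2 = 1 + t^2]
    ([symabsmx_witness], [qsymabsmx_witness]).

    An inequality [A <= c U B U^*] with [U] unitary forces the second largest
    eigenvalue of [A] to be at most [c] times that of [B]
    ([loewner_le_diag2_second]).  Here it would give [r t <= c t^2], hence
    [1 <= r <= c t], which fails for [t = 1 / (1 + c)]. *)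

Import Order.TTheory GRing.Theory Num.Theory.
Local Open Scope ring_scope.
Local Open Scope sesquilinear_scope.
Local Open Scope complex_scope.

Section RankOne.
Context {C : numClosedFieldType} {n : nat}.

Lemma psdmx_outer (y : 'cV[C]_n) : psdmx (y *m y ^t*).
Proof.
split=> [|z]; first by apply: trC_hermsymmx; rewrite trC_mul trmxCK.
rewrite mulmxA -mulmxA -{1}[y]trmxCK -trC_mul !mxE; apply: sumr_ge0 => i _.
by rewrite !mxE mulrC mul_conjC_ge0.
Qed.

(** Equality of norms is what makes the square of [y y^*], namely [|y|^2 y y^*],
    coincide with [X^* X = |x|^2 y y^*]. *)
Lemma absmx_outer (x y : 'cV[C]_n) :
  x ^t* *m x = y ^t* *m y -> absmx (x *m y ^t*) = y *m y ^t*.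
Proof.
move=> xy; apply/esym/sqrtmx_unique; first exact: psdmx_gram.
  exact: psdmx_outer.
by rewrite trC_mul trmxCK !mulmxA -(mulmxA y) -xy mulmxA.
Qed.

End RankOne.

Section TwoCoordinates.
Context {C : numClosedFieldType} {n : nat}.
Variables i0 i1 : 'I_n.
Hypothesis i01 : i0 != i1.

Definition diag2 (a b : C) : 'M[C]_n :=
  a *: delta_mx i0 i0 + b *: delta_mx i1 i1.

Lemma diag2_form (a b : C) (w : 'cV[C]_n) :
  (w ^t* *m diag2 a b *m w) 0 0 = a * `|w i0 0| ^+ 2 + b * `|w i1 0| ^+ 2.
Proof.
have formE i : (w ^t* *m delta_mx i i *m w) 0 0 = `|w i 0| ^+ 2.
  rewrite -(mul_delta_mx (0 : 'I_1)) mulmxA -colE -mulmxA -rowE.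
  by rewrite mxE big_ord1 !mxE normCK mulrC.
rewrite mulmxDr mulmxDl mxE -!scalemxAr -!scalemxAl.
by rewrite [X in X + _]mxE [X in _ + X]mxE !formE.
Qed.

Lemma trC_diag2 (a b : C) : 0 <= a -> 0 <= b -> (diag2 a b) ^t* = diag2 a b.
Proof.
move=> a0 b0; apply/matrixP=> i j; rewrite !mxE rmorphD !rmorphM /= !conjC_nat.
rewrite !conj_Creal ?ger0_real //.
by rewrite [(j == i0) && _]andbC [(j == i1) && _]andbC.
Qed.

Lemma psdmx_diag2 (a b : C) : 0 <= a -> 0 <= b -> psdmx (diag2 a b).
Proof.
move=> a0 b0; split=> [|w]; first exact/trC_hermsymmx/trC_diag2.
by rewrite diag2_form addr_ge0 // mulr_ge0 // exprn_ge0.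
Qed.

Lemma mul_diag2 (a b a' b' : C) :
  diag2 a b *m diag2 a' b' = diag2 (a * a') (b * b').
Proof.
rewrite /diag2 mulmxDr !mulmxDl -!scalemxAr -!scalemxAl.
rewrite !mul_delta_mx_cond !eqxx (negbTE i01) eq_sym (negbTE i01).
by rewrite !mulr0n !mulr1n !scaler0 addr0 add0r !scalerA mulrC [b * _]mulrC.
Qed.

Lemma scale_diag2 (k a b : C) : k *: diag2 a b = diag2 (k * a) (k * b).
Proof. by rewrite scalerDr !scalerA. Qed.

Definition span2 (p q : C) : 'cV[C]_n :=
  p *: delta_mx i0 0 + q *: delta_mx i1 0.

Lemma span2_i0 p q : span2 p q i0 0 = p.
Proof. by rewrite !mxE !eqxx (negbTE i01) mulr1 mulr0 addr0. Qed.

Lemma span2_i1 p q : span2 p q i1 0 = q.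
Proof. by rewrite !mxE !eqxx eq_sym (negbTE i01) mulr1 mulr0 add0r. Qed.

Lemma trC_span2 p q :
  (span2 p q) ^t* = p^* *: delta_mx 0 i0 + q^* *: delta_mx 0 i1.
Proof.
apply/matrixP=> i j; rewrite !mxE rmorphD !rmorphM /= !conjC_nat.
by rewrite [(j == i0) && _]andbC [(j == i1) && _]andbC.
Qed.

Lemma sqnorm_span2 p q :
  (span2 p q) ^t* *m span2 p q = (`|p| ^+ 2 + `|q| ^+ 2)%:M.
Proof.
rewrite trC_span2 /span2 mulmxDr !mulmxDl -!scalemxAr -!scalemxAl.
rewrite !mul_delta_mx_cond !eqxx (negbTE i01) eq_sym (negbTE i01).
rewrite !mulr0n !mulr1n !scaler0 addr0 add0r !scalerA -scalerDl !normCK.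
by apply/matrixP=> i j; rewrite !ord1 !mxE mulr1.
Qed.

(** Dimension count: a plane and a hyperplane share a nonzero vector. *)
Lemma span2_in_hyperplane (f : 'rV[C]_n) :
  exists p q, 0 < `|p| ^+ 2 + `|q| ^+ 2 /\ (f *m span2 p q) 0 0 = 0.
Proof.
have fE p q : (f *m span2 p q) 0 0 = p * f 0 i0 + q * f 0 i1.
  by rewrite mulmxDr -!scalemxAr -!colE !mxE.
have [f0|f0] := eqVneq (f 0 i0) 0.
  exists 1, 0; rewrite fE f0 mulr0 mul0r addr0; split=> //.
  by rewrite normr1 normr0 expr1n expr0n addr0.
exists (f 0 i1), (- f 0 i0); rewrite fE; split.
  by rewrite ltr_wpDl ?exprn_ge0 // exprn_gt0 // normr_gt0 oppr_eq0.
by rewrite mulNr mulrC subrr.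
Qed.

Lemma sqnorm_coord_le (w : 'cV[C]_n) (i : 'I_n) :
  `|w i 0| ^+ 2 <= (w ^t* *m w) 0 0.
Proof.
rewrite mxE (bigD1 i) //= !mxE normCK mulrC lerDl.
by apply: sumr_ge0 => j _; rewrite !mxE mulrC mul_conjC_ge0.
Qed.

(** The instance of Weyl monotonicity for second eigenvalues that is needed,
    by the min-max argument: some nonzero [v] in the plane of the two coordinates
    has [U^* v] orthogonal to [e_i0].  On it the left form is at least [b |v|^2],
    and the right one only sees [b'], so it is at most [c b' |v|^2]. *)
Lemma loewner_le_diag2_second (U : 'M[C]_n) (a b a' b' c : C) :
    U \is unitarymx -> b <= a -> 0 <= b' -> 0 <= c ->
  loewner_le (diag2 a b) (c *: (U *m diag2 a' b' *m U ^t*)) -> b <= c * b'.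
Proof.
move=> uU ba b'0 c0 [_ le_form].
have [p [q [pq0 fpq]]] := span2_in_hyperplane (row i0 (U ^t*)).
set v := span2 p q in fpq; set w := U ^t* *m v.
have w0 : w i0 0 = 0 by move: fpq; rewrite -row_mul mxE.
have wv : (w ^t* *m w) 0 0 = `|p| ^+ 2 + `|q| ^+ 2.
  rewrite /w trC_mul trmxCK mulmxA -(mulmxA _ U) (unitarymxP uU) mulmx1.
  by rewrite sqnorm_span2 mxE eqxx mulr1n.
have := le_form v.
rewrite mulmxBr mulmxBl mxE [X in _ + X]mxE diag2_form.
rewrite span2_i0 span2_i1 subr_ge0.
have -> : v ^t* *m (c *: (U *m diag2 a' b' *m U ^t*)) *m v
          = c *: (w ^t* *m diag2 a' b' *m w).
  by rewrite /w trC_mul trmxCK -scalemxAr -scalemxAl !mulmxA.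
rewrite mxE diag2_form w0 normr0 expr0n mulr0 add0r => le_v.
rewrite -(ler_pM2r pq0); apply: (le_trans _ (le_trans le_v _)).
  by rewrite mulrDr lerD2r ler_wpM2r ?exprn_ge0.
by rewrite mulrA ler_wpM2l ?mulr_ge0 // -wv sqnorm_coord_le.
Qed.

Section Witness.
Variable t : C.
Hypothesis t_gt0 : 0 < t.

Let x := span2 1 t.
Let y := span2 1 (- t).

Definition witness : 'M[C]_n := x *m y ^t*.

Let xy_norm : x ^t* *m x = y ^t* *m y.
Proof. by rewrite !sqnorm_span2 normrN. Qed.

Let x_norm : x ^t* *m x = (1 + t ^+ 2)%:M.
Proof. by rewrite sqnorm_span2 normr1 expr1n gtr0_norm. Qed.

Let absmx_witness : absmx witness = y *m y ^t*.
Proof. exact: absmx_outer. Qed.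

Let absmx_witnessC : absmx (witness ^t*) = x *m x ^t*.
Proof. by rewrite /witness trC_mul trmxCK absmx_outer. Qed.

Let sum_outer : y *m y ^t* + x *m x ^t* = 2 *: diag2 1 (t ^+ 2).
Proof.
rewrite !trC_span2 /x /y /span2 !rmorphN /= !conjC1.
rewrite (conj_Creal (gtr0_real t_gt0)).
rewrite !mulmxDr !mulmxDl -!scalemxAr -!scalemxAl !mul_delta_mx !scalerA.
rewrite !mulrNN !mulr1 !mul1r scale_diag2 /diag2 expr2 mulr1.
by apply/matrixP=> i j; rewrite !mxE; ring.
Qed.

Lemma symabsmx_witness : symabsmx witness = diag2 1 (t ^+ 2).
Proof.
rewrite /symabsmx absmx_witness absmx_witnessC sum_outer scalerA.
by rewrite mulVf ?pnatr_eq0 // scale1r.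
Qed.

(** Squaring [y y^*] and [x x^*] multiplies both by the same squared norm, so
    the argument of the square root is [1 + t^2] times the arithmetic modulus. *)
Lemma qsymabsmx_witness :
  qsymabsmx witness = diag2 (sqrtC (1 + t ^+ 2)) (sqrtC (1 + t ^+ 2) * t).
Proof.
have r0 : 0 <= sqrtC (1 + t ^+ 2).
  by rewrite sqrtC_ge0 addr_ge0 // exprn_ge0 // ltW.
apply/esym/sqrtmx_unique; first exact: qsymabsmx_arg_psd.
  by apply: psdmx_diag2; rewrite // mulr_ge0 // ltW.
rewrite mul_diag2 absmx_witness absmx_witnessC.
have sq z : z ^t* *m z = (1 + t ^+ 2)%:M ->
    z *m z ^t* *m (z *m z ^t*) = (1 + t ^+ 2) *: (z *m z ^t*).
  by move=> zE; rewrite mulmxA -(mulmxA z) zE mul_mx_scalar -scalemxAl.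
rewrite !sq -?xy_norm // -scalerDr sum_outer !scalerA [2^-1 * _]mulrCA.
rewrite mulVf ?pnatr_eq0 //.
by rewrite scale_diag2 !mulr1 mulrACA -!expr2 sqrtCK.
Qed.

End Witness.
End TwoCoordinates.

Theorem proposition3p2 (R : realType) (n : nat) (hn : (2 <= n)%N) :
  ~ exists c : R, 0 < c /\
      forall X : 'M[R[i]]_n, exists U : 'M[R[i]]_n,
        U \is unitarymx /\
        loewner_le (qsymabsmx X) (c%:C *: (U *m symabsmx X *m U ^t*)).
Proof.
case=> c [c_gt0 bound].
pose i0 : 'I_n := Ordinal (ltnW hn); pose i1 : 'I_n := Ordinal hn.
have i01 : i0 != i1 by [].
have k_gt0 : 0 < c%:C by rewrite ltcR.
move: c%:C k_gt0 bound => k k_gt0 bound.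
have k1_gt0 : 0 < 1 + k by rewrite addr_gt0.
pose t := (1 + k)^-1.
have t_gt0 : 0 < t by rewrite invr_gt0.
have t_le1 : t <= 1 by rewrite invf_le1 // lerDl ltW.
have [U [uU]] := bound (witness i0 i1 t).
rewrite symabsmx_witness // qsymabsmx_witness //.
set r := sqrtC _ => le_kU.
have t2_ge0 : 0 <= t ^+ 2 by rewrite exprn_ge0 // ltW.
have r_ge1 : 1 <= r.
  by rewrite -[1]sqrtC1 ler_sqrtC ?qualifE /= ?lerDl // addr_ge0.
have r_ge0 : 0 <= r by apply: le_trans r_ge1.
have r_t_le : r * t <= r by rewrite ler_piMr.
have := loewner_le_diag2_second _ _ i01 _ _ _ _ _ _ uU r_t_le t2_ge0
  (ltW k_gt0) le_kU.
rewrite expr2 mulrA ler_pM2r // => r_le.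
have : 1 <= k * t by apply: le_trans r_le.
by rewrite ler_pdivlMr // mul1r gerDr ler10.
Qed.
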